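(* Let $p>1$, $0<h\le 1$ with $ph>1$. There is a constant $C_{p,h}>0$ depending only on $p$ and $h$ such that the following holds. Let $\{X_t\}_{t\in[0,T]}$ be a continuous $\{\mathcal F_t\}$-adapted $\mathbb R^d$-valued process satisfying the conditional increment control with parameter $(p,h)$ and constant $A_{p,h}$, that is, $X_t\in L^p(\Omega,\mathbb R^d)$ for all $t\in[0,T]$ and $$\mathbb E\left[\left|\mathbb E(X_t\mid\mathcal F_s)-X_s\right|^p\right]\le A_{p,h}|t-s|^{ph}\qquad\text{for all }0\le s<t\le T.$$ Let $0\le s_0<t_0\le T$ and $X^*=\sup_{u\in[s_0,t_0]}|X_u|$. Then for any $1<q\le p$, $$\|X^*\|_{L^q}\le\frac{q}{q-1}\left[C_{p,h}^{1/p}A_{p,h}^{1/p}|t_0-s_0|^h+\|X_{t_0}\|_{L^q}\right].$$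
   Context: $(\Omega,\{\mathcal F_t\}_{t\ge0},\mathcal F,\mathbb P)$ is a filtered probability space satisfying the usual conditions, and $T>0$ is fixed. $A_{p,h}\ge 0$ is a constant independent of $s$ and $t$. $\|\cdot\|_{L^q}$ denotes the $L^q(\Omega,\mathbb P)$ norm. *)

(* Defs.v *)
From HB Require Import structures.
From mathcomp Require Import all_boot all_order all_algebra.
From mathcomp Require Import all_classical all_reals all_analysis.

Set Implicit Arguments.
Unset Strict Implicit.
Unset Printing Implicit Defensive.

Import Order.TTheory GRing.Theory Num.Theory.
Import numFieldNormedType.Exports.

Local Open Scope classical_set_scope.
Local Open Scope ring_scope.

(* The library norm on 'rV[R]_n is the sup norm, hence this definition. *)
Definition enorm (R : realType) (n : nat) (x : 'rV[R]_n) : R :=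
  Num.sqrt (\sum_(i < n) x 0 i ^+ 2).

(* When G is a sigma-algebra, the measurable sets of [g_sigma_algebraType G]
   are exactly the elements of G. *)
Definition measurable_wrt (disp : measure_display) (T : measurableType disp)
    (R : realType) (G : set (set T)) (Y : T -> R) : Prop :=
  measurable_fun [set: g_sigma_algebraType G] (Y : g_sigma_algebraType G -> R).

(* The Borel sigma-algebra of R^n is the product one, so that measurability of
   a random vector is measurability of its coordinates. *)
Definition measurable_vec_wrt (disp : measure_display)
    (T : measurableType disp) (R : realType) (n : nat) (G : set (set T))
    (Y : T -> 'rV[R]_n) : Prop :=
  forall i, measurable_wrt G (fun w => Y w 0 i).

(* Only the times t >= 0 are relevant. *)
Definition filtration (disp : measure_display) (T : measurableType disp)
    (R : realType) (F : R -> set (set T)) : Prop :=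
  [/\ forall t, 0 <= t -> sigma_algebra [set: T] (F t),
      forall t, 0 <= t -> F t `<=` measurable
    & forall s t, 0 <= s -> s <= t -> F s `<=` F t].

(* [P.-negligible] sets are subsets of measurable null sets; for a filtration,
   the first clause thus also entails that P is complete. *)
Definition usual_conditions (disp : measure_display)
    (T : measurableType disp) (R : realType) (P : probability T R)
    (F : R -> set (set T)) : Prop :=
  (forall N, P.-negligible N -> F 0 N) /\
  (forall t, 0 <= t -> \bigcap_(u in `]t, +oo[) F u = F t).

(* Y is a version of E(X | G). *)
Definition is_cond_exp (disp : measure_display) (T : measurableType disp)
    (R : realType) (P : probability T R) (G : set (set T)) (X Y : T -> R)
    : Prop :=
  [/\ measurable_wrt G Y,
      P.-integrable [set: T] (EFin \o Y)
    & forall B, G B ->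
        ((\int[P]_(w in B) (Y w)%:E) = (\int[P]_(w in B) (X w)%:E))%E].

Definition is_cond_exp_vec (disp : measure_display) (T : measurableType disp)
    (R : realType) (P : probability T R) (n : nat) (G : set (set T))
    (X Y : T -> 'rV[R]_n) : Prop :=
  forall i, is_cond_exp P G (fun w => X w 0 i) (fun w => Y w 0 i).

Definition Lnorm_vec (disp : measure_display) (T : measurableType disp)
    (R : realType) (P : probability T R) (n : nat) (q : R)
    (X : T -> 'rV[R]_n) : \bar R :=
  (Lnorm P q%:E (fun w => (enorm (X w))%:E))%E.

Definition in_Lp_vec (disp : measure_display) (T : measurableType disp)
    (R : realType) (P : probability T R) (n : nat) (q : R)
    (X : T -> 'rV[R]_n) : Prop :=
  (forall i, measurable_fun [set: T] (fun w => X w 0 i)) /\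
  (Lnorm_vec P q X < +oo)%E.

Definition adapted (disp : measure_display) (T : measurableType disp)
    (R : realType) (n : nat) (F : R -> set (set T)) (tau : R)
    (X : R -> T -> 'rV[R]_n) : Prop :=
  forall t, 0 <= t <= tau -> measurable_vec_wrt (F t) (X t).

(* Continuity is only required of almost every path. *)
Definition continuous_process (disp : measure_display)
    (T : measurableType disp) (R : realType) (P : probability T R) (n : nat)
    (tau : R) (X : R -> T -> 'rV[R]_n) : Prop :=
  {ae P, forall w, {within `[0, tau], continuous (fun t : R => X t w)}}.

(* Versions of E(X_t | F_s) exist and agree almost surely, so it is immaterial
   which one is used. *)
Definition cond_increment_control (disp : measure_display)
    (T : measurableType disp) (R : realType) (P : probability T R) (n : nat)
    (F : R -> set (set T)) (tau : R) (X : R -> T -> 'rV[R]_n) (p h A : R)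
    : Prop :=
  (forall t, 0 <= t <= tau -> in_Lp_vec P p (X t)) /\
  (forall s t : R, 0 <= s -> s < t -> t <= tau ->
     exists2 Y : T -> 'rV[R]_n, is_cond_exp_vec P (F s) (X t) Y &
       ('E_P[fun w => (enorm (Y w - X s w) `^ p)%R]
          <= (A * `|t - s| `^ (p * h))%R%:E)%E).

Definition running_sup (T : Type) (R : realType) (n : nat)
    (X : R -> T -> 'rV[R]_n) (a b : R) (w : T) : \bar R :=
  ereal_sup [set (enorm (X u w))%:E | u in `[a, b]].

(* Main.v *)
Require Import Defs.
From HB Require Import structures.
From mathcomp Require Import all_boot all_order all_algebra.
From mathcomp Require Import all_classical all_reals all_analysis.
From mathcomp Require Import measurable_realfun zify ring lra.

(** The idea is Doob's maximal inequality for a process that is a martingale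
    up to an error which dyadic chaining controls.  Write L = t0 - s0.

    Chaining.  On the level-n dyadic grid of [s0, t0] every point climbs to t0
    through the coarser grids: a point of odd index moves to its right
    neighbour on its own level, a point of even index already belongs to the
    next coarser level.  So it makes at most one step per level k, and
    that step costs |E(X_{t'} | F_t) - X_t| for neighbours t < t' of level k,
    which is at most Z_k, the l^p norm of these quantities over the whole
    level.  Hence, for each grid time t and each bounded F_t-measurable vector
    phi,
      E(phi . X_t) <= E(|phi| (|X_{t0}| + Z_0 + ... + Z_n))
    ([dyadic_chain]).  The increment control gives
    E(Z_k ^ p) <= 2^k A (L / 2^k)^(ph), so that ||Z_k||_p is at most
    A^(1/p) L^h r^k with r = 2^(1/p - h) ([Lnorm_lp_sum], [level_boundE]).
    Since ph > 1 the ratio r is less than 1, the series converges, and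
    C = (1 - r)^(-p) is the constant of the theorem.

    Maximal inequality.  Let M_j be the maximum of |X| over the first j grid
    points, truncated so that all weights below are bounded.  It only moves at
    times when |X| is at least its new value, and Young's inequality turns this
    into the pathwise bound
      (1 - 1/q) M_J^q <= sum_j (M_{j+1}^(q-1) - M_j^(q-1)) |X_{t_j}|
    ([trunc_max_powR_le]).  Taking expectations with phi the weight times the
    unit vector X_{t_j} / |X_{t_j}|, the chaining estimate bounds the right
    side by E(M_J^(q-1) W), where W is the error bound above, and Hoelder's
    inequality yields ||M_J||_q <= q/(q-1) ||W||_q ([doob_Lq_inequality]).
    Only pairings phi . X at deterministic times occur, so that vector-valued
    processes are treated like real ones.

    Passage to the limit.  By Minkowski's inequality and ||.||_q <= ||.||_p the
    bound on ||W||_q is uniform in n; refining the grid and raising the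
    truncation level makes the discrete maxima increase to the running
    supremum along every continuous path, and monotone convergence
    concludes. *)

Set Implicit Arguments.
Unset Strict Implicit.
Unset Printing Implicit Defensive.

Import Order.TTheory GRing.Theory Num.Theory.
Import numFieldNormedType.Exports.

Local Open Scope classical_set_scope.
Local Open Scope ring_scope.

(** * Integration against a probability *)

Section integration.
Context (disp : measure_display) (T : measurableType disp) (R : realType).
Variable P : probability T R.

Local Notation integ f := (P.-integrable [set: T] (EFin \o f)).

Lemma integrable_le_norm (f g : T -> R) : measurable_fun [set: T] f ->
  integ g -> (forall w, `|f w| <= g w) -> integ f.
Proof.
move=> mf ig fg; apply: le_integrable ig => //; first exact/measurable_EFinP.
by move=> w _; rewrite /= lee_fin (le_trans (fg w))// ler_norm.
Qed.

Lemma integrable_bounded_mul (K : R) (f g : T -> R) :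
  measurable_fun [set: T] f -> (forall w, `|f w| <= K) ->
  integ g -> integ (fun w => f w * g w).
Proof.
move=> mf fK ig; have mg : measurable_fun [set: T] g.
  by apply/measurable_EFinP; exact: measurable_int ig.
apply: (@integrable_le_norm _ (fun w => K * `|g w|)).
- exact: measurable_funM.
- by apply: (eq_integrable measurableT _ _ _ (integrableZl measurableT K
    (integrable_norm ig))).
- by move=> w; rewrite normrM ler_wpM2r.
Qed.

Lemma integrableD_fun (f g : T -> R) : integ f -> integ g ->
  integ (fun w => f w + g w).
Proof. by move=> fi gi; exact: (integrableD measurableT fi gi). Qed.

Lemma integrableB_fun (f g : T -> R) : integ f -> integ g ->
  integ (fun w => f w - g w).
Proof. by move=> fi gi; exact: (integrableB measurableT fi gi). Qed.

Lemma integrable_sum_fun (I : Type) (s : seq I) (f : I -> T -> R) :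
  (forall i, integ (f i)) -> integ (fun w => \sum_(i <- s) f i w).
Proof.
move=> fi; elim: s => [|i s IH].
  rewrite (_ : (fun _ => _) = cst 0).
    exact: finite_measure_integrable_cst.
  by apply/funext => w; rewrite big_nil.
rewrite (_ : (fun _ => _) = fun w => f i w + \sum_(j <- s) f j w).
  exact: integrableD_fun.
by apply/funext => w; rewrite big_cons.
Qed.

Lemma Rintegral_sum (I : Type) (s : seq I) (f : I -> T -> R) :
  (forall i, integ (f i)) ->
  \int[P]_w (\sum_(i <- s) f i w) = \sum_(i <- s) \int[P]_w f i w.
Proof.
move=> fi; elim: s => [|i s IH].
  rewrite big_nil; under eq_Rintegral do rewrite big_nil.
  by rewrite /Rintegral integral0.
rewrite big_cons -IH -RintegralD//; last exact: integrable_sum_fun.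
by under eq_Rintegral do rewrite big_cons.
Qed.

End integration.

(** * Pairing a conditional expectation with a bounded multiplier *)

Section conditional_expectation.
Context (disp : measure_display) (T : measurableType disp) (R : realType).
Variable P : probability T R.

Local Notation integ f := (P.-integrable [set: T] (EFin \o f)).

Lemma g_sigma_algebra_in (G : set (set T)) (B : set (g_sigma_algebraType G)) :
  sigma_algebra [set: T] G -> measurable B -> G B.
Proof. by move=> sG mB; rewrite -(sigma_algebra_id sG). Qed.

Lemma measurable_wrt_measurable (G : set (set T)) (f : T -> R) :
  sigma_algebra [set: T] G -> G `<=` measurable -> measurable_wrt G f ->
  measurable_fun [set: T] f.
Proof.
move=> sG Gm mf _ B mB; apply: Gm.
exact: (g_sigma_algebra_in sG (mf measurableT B mB)).
Qed.

Lemma measurable_wrt_sub (G H : set (set T)) (f : T -> R) :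
  G `<=` H -> measurable_wrt G f -> measurable_wrt H f.
Proof.
move=> GH mf _ B mB; have := mf measurableT B mB.
exact: sub_sigma_algebra2.
Qed.

Import HBNNSimple.

(** True by hypothesis for indicators of [G], hence for [G]-simple functions; a
    nonnegative [phi] is an increasing limit of such functions, which it
    dominates, so dominated convergence applies. *)
Lemma Rintegral_mul_eq0 (G : set (set T)) (D phi : T -> R) (K : R) :
  sigma_algebra [set: T] G -> G `<=` measurable -> integ D ->
  (forall B, G B -> \int[P]_(w in B) D w = 0) ->
  measurable_wrt G phi -> (forall w, 0 <= phi w <= K) ->
  \int[P]_w (phi w * D w) = 0.
Proof.
move=> sG Gm iD D0 mphi phi0K.
have mD : measurable_fun [set: T] D.
  by apply/measurable_EFinP; exact: measurable_int iD.
have mphi' : measurable_fun [set: g_sigma_algebraType G] (EFin \o phi).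
  exact/measurable_EFinP.
pose g n : {nnsfun (g_sigma_algebraType G) >-> R} :=
  nnsfun_approx measurableT mphi' n.
have phi0 x : [set: g_sigma_algebraType G] x -> (0 <= (EFin \o phi) x)%E.
  by move=> _; rewrite lee_fin; case/andP: (phi0K x).
have gle n w : 0 <= g n w <= K.
  rewrite fun_ge0 /=; apply: (@le_trans _ _ (phi w)); last by case/andP: (phi0K w).
  by rewrite -lee_fin /g nnsfun_approxE; exact: le_approx.
have mg n : measurable_fun [set: T] (g n).
  by apply: (measurable_wrt_measurable sG Gm) => //; exact: measurable_funPT.
have step n : \int[P]_w (g n w * D w) = 0.
  have Gpre y : G (g n @^-1` [set y]).
    exact: (g_sigma_algebra_in sG (measurable_sfunP _ _)).
  have ind y : measurable_fun [set: T] (\1_(g n @^-1` [set y]) : T -> R).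
    by apply: measurable_indic; exact: Gm.
  have bind y (w : T) : `|(\1_(g n @^-1` [set y]) w : R)| <= 1.
    by rewrite indicE; case: (_ \in _); rewrite ?normr1 ?normr0.
  have iy y : integ (fun w => y * (\1_(g n @^-1` [set y]) w * D w)).
    apply: (@integrable_bounded_mul _ _ _ _ `|y|) => //.
    exact: (@integrable_bounded_mul _ _ _ _ 1).
  under eq_Rintegral => w _.
    rewrite (fimfunE (g n)) fsbig_finite//= mulr_suml.
    under eq_bigr do rewrite -mulrA.
    over.
  rewrite Rintegral_sum// big1// => y _.
  rewrite RintegralZl//; last exact: (@integrable_bounded_mul _ _ _ _ 1).
  rewrite -[X in _ * X = _](_ : \int[P]_(w in g n @^-1` [set y]) D w = _).
    by rewrite D0// mulr0.
  rewrite Rintegral_mkcond; apply: eq_Rintegral => w _.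
  by rewrite patchE indicE; case: ifPn; rewrite ?mul1r ?mul0r.
have stepE n : (\int[P]_w (g n w * D w)%:E = 0)%E.
  rewrite -[LHS]fineK; first by congr EFin; exact: step.
  apply: integrable_fin_num => //.
  apply: (@integrable_bounded_mul _ _ _ _ K) => // w.
  by have /andP[? ?] := gle n w; rewrite ger0_norm.
suff cv : (\int[P]_w (g n w * D w)%:E)%E @[n --> \oo] -->
          (\int[P]_w (phi w * D w)%:E)%E.
  rewrite /Rintegral -(cvg_lim _ cv)//.
  by under eq_fun do rewrite stepE; rewrite lim_cst.
apply: (@dominated_cvg _ _ _ P _ measurableT _ _ (fun w => (K * `|D w|)%:E)).
- by move=> n; apply/measurable_EFinP; exact: measurable_funM.
- move=> w _; under eq_fun do rewrite EFinM.
  rewrite EFinM; apply: cvgeM.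
  + by rewrite mule_def_fin.
  + exact: (cvg_nnsfun_approx measurableT mphi' phi0 I).
  + exact: cvg_cst.
- by [].
- by apply: (eq_integrable measurableT _ _ _ (integrableZl measurableT K
    (integrable_norm iD))).
- move=> n w _; rewrite lee_fin normrM ler_wpM2r//.
  by have /andP[? ?] := gle n w; rewrite ger0_norm.
Qed.

(** The difference [Y - X] integrates to zero over [G], and the shifted multiplier
    [phi + K] is nonnegative, which reduces this to [Rintegral_mul_eq0]. *)
Lemma cond_exp_pull_out (G : set (set T)) (X Y phi : T -> R) (K : R) :
  sigma_algebra [set: T] G -> G `<=` measurable -> integ X ->
  is_cond_exp P G X Y ->
  measurable_wrt G phi -> (forall w, `|phi w| <= K) ->
  \int[P]_w (phi w * Y w) = \int[P]_w (phi w * X w).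
Proof.
move=> sG Gm iX [_ iY YX] mphi phiK.
have iD := integrableB_fun iY iX.
have D0 B : G B -> \int[P]_(w in B) (Y w - X w) = 0.
  move=> GB; have mB := Gm _ GB.
  rewrite RintegralB//; [|exact: integrableS iY|exact: integrableS iX].
  by rewrite /Rintegral YX// subrr.
have mphi' := measurable_wrt_measurable sG Gm mphi.
have iphi f : integ f -> integ (fun w => phi w * f w).
  exact: (@integrable_bounded_mul _ _ _ _ K).
apply/eqP; rewrite -subr_eq0 -RintegralB//; [|exact: iphi|exact: iphi].
have shift0 : \int[P]_w ((phi w + K) * (Y w - X w)) = 0.
  apply: (@Rintegral_mul_eq0 G _ _ (K + K)) => //.
    exact: measurable_funD.
  by move=> w; have := phiK w; rewrite ler_norml -lerBlDr sub0r lerD2r.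
have KD0 : \int[P]_w (K * (Y w - X w)) = 0.
  rewrite RintegralZl// D0 ?mulr0//.
  exact: (g_sigma_algebra_in sG measurableT).
apply/eqP; rewrite -[RHS]shift0 -[LHS]addr0 -[X in _ + X]KD0 -RintegralD//.
- by apply: eq_Rintegral => w _; rewrite mulrDl (mulrBr (phi w)).
- by apply: (eq_integrable measurableT _ _ _ (iphi _ iD)) => w _ /=; rewrite mulrBr.
- exact: (integrableZl measurableT K iD).
Qed.

End conditional_expectation.

(** * The Euclidean norm *)

Section euclidean_norm.
Context (R : realType) (n : nat).
Implicit Types x y : 'rV[R]_n.

Definition edot x y : R := \sum_(i < n) x 0 i * y 0 i.

Lemma enorm_ge0 x : 0 <= enorm x.
Proof. exact: sqrtr_ge0. Qed.

Lemma sum_sqr_ge0 x : 0 <= \sum_(i < n) x 0 i ^+ 2.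
Proof. by apply: sumr_ge0 => i _; exact: sqr_ge0. Qed.

Lemma sqr_enorm x : enorm x ^+ 2 = \sum_(i < n) x 0 i ^+ 2.
Proof. by rewrite sqr_sqrtr// sum_sqr_ge0. Qed.

Lemma edotxx x : edot x x = enorm x ^+ 2.
Proof. by rewrite sqr_enorm; apply: eq_bigr => i _; rewrite expr2. Qed.

Lemma coord_le_enorm x i : `|x 0 i| <= enorm x.
Proof.
rewrite -(ler_pXn2r (n:=2))// ?nnegrE ?enorm_ge0// sqr_enorm.
rewrite -normrX ger0_norm ?sqr_ge0// (bigD1 i)//= lerDl.
by apply: sumr_ge0 => j _; exact: sqr_ge0.
Qed.

Lemma enorm_eq0 x : enorm x = 0 -> x = 0.
Proof.
move=> x0; apply/rowP => i; apply/eqP; rewrite mxE -normr_le0 -x0.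
exact: coord_le_enorm.
Qed.

Lemma enormZ (a : R) x : enorm (a *: x) = `|a| * enorm x.
Proof.
rewrite /enorm -sqrtr_sqr -sqrtrM ?sqr_ge0// mulr_sumr.
by congr Num.sqrt; apply: eq_bigr => i _; rewrite mxE exprMn.
Qed.

(** Cauchy-Schwarz, from expanding the squares of the coordinates of
    [enorm y *: x - enorm x *: y]. *)
Lemma edot_le x y : edot x y <= enorm x * enorm y.
Proof.
have [/eqP x0|x0] := eqVneq (enorm x) 0.
  by rewrite (eqP x0) mul0r /edot big1// => i _; rewrite (enorm_eq0 (eqP x0)) mxE mul0r.
have [/eqP y0|y0] := eqVneq (enorm y) 0.
  by rewrite (eqP y0) mulr0 /edot big1// => i _; rewrite (enorm_eq0 (eqP y0)) mxE mulr0.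
have xy0 : 0 < enorm x * enorm y by rewrite mulr_gt0// lt_def enorm_ge0 andbT.
rewrite -(ler_pM2l xy0) -(ler_pM2l (ltr0Sn _ 1)) -subr_ge0.
have -> : 2 * (enorm x * enorm y * (enorm x * enorm y)) -
    2 * (enorm x * enorm y * edot x y) =
    \sum_(i < n) (enorm y * x 0 i - enorm x * y 0 i) ^+ 2.
  transitivity (enorm y ^+ 2 * (\sum_(i < n) x 0 i ^+ 2)
     - 2 * (enorm x * enorm y) * (\sum_(i < n) x 0 i * y 0 i)
     + enorm x ^+ 2 * (\sum_(i < n) y 0 i ^+ 2)).
    by rewrite -!sqr_enorm /edot; ring.
  rewrite !mulr_sumr -sumrB -big_split/=.
  by apply: eq_bigr => i _; ring.
by apply: sumr_ge0 => i _; exact: sqr_ge0.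
Qed.

Lemma edotBr x y z : edot x (y - z) = edot x y - edot x z.
Proof. by rewrite /edot -sumrB; apply: eq_bigr => i _; rewrite !mxE mulrBr. Qed.

Lemma continuous_enorm : continuous (@enorm R n).
Proof.
have sum_cont : continuous (fun x : 'rV[R]_n => \sum_(i < n) x 0 i ^+ 2).
  apply: continuous_big => [|i _ y]; first exact: add_continuous.
  have cy := @coord_continuous R _ _ 0 i y.
  exact: (cvgM cy cy).
move=> x; apply: (@continuous_comp _ _ _
  (fun x : 'rV[R]_n => \sum_(i < n) x 0 i ^+ 2) Num.sqrt).
  exact: sum_cont.
exact: sqrt_continuous.
Qed.

Lemma measurable_enorm disp (T : measurableType disp) (X : T -> 'rV[R]_n) :
  (forall i, measurable_fun [set: T] (fun w => X w 0 i)) ->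
  measurable_fun [set: T] (fun w => enorm (X w)).
Proof.
move=> mX; rewrite (_ : (fun _ => _) =
    (fun w => (\sum_(i < n) X w 0 i ^+ 2) `^ 2^-1)).
  apply: (@measurableT_comp _ _ _ _ _ _ (@powR R ^~ 2^-1)) => //.
  by apply: measurable_sum => i; exact: measurable_funX.
by apply/funext => w; rewrite powR12_sqrt ?sum_sqr_ge0.
Qed.

End euclidean_norm.

(** * Dyadic chaining *)

Section dyadic_chaining.
Context (disp : measure_display) (T : measurableType disp) (R : realType).
Context (P : probability T R) (d : nat).

Local Notation integ f := (P.-integrable [set: T] (EFin \o f)).

Lemma integrable_edot (K : R) (phi U : T -> 'rV[R]_d) :
  (forall i, measurable_fun [set: T] (fun w => phi w 0 i)) ->
  (forall w, enorm (phi w) <= K) ->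
  (forall i, integ (fun w => U w 0 i)) -> integ (fun w => edot (phi w) (U w)).
Proof.
move=> mphi phiK iU; apply: integrable_sum_fun => i.
apply: (@integrable_bounded_mul _ _ _ _ K) => // w.
exact: le_trans (coord_le_enorm _ _) (phiK w).
Qed.

Lemma integrable_enorm_mul (K : R) (phi : T -> 'rV[R]_d) (W : T -> R) :
  (forall i, measurable_fun [set: T] (fun w => phi w 0 i)) ->
  (forall w, enorm (phi w) <= K) ->
  integ W -> integ (fun w => enorm (phi w) * W w).
Proof.
move=> mphi phiK iW; apply: (@integrable_bounded_mul _ _ _ _ K) => //.
  exact: measurable_enorm.
by move=> w; rewrite ger0_norm// enorm_ge0.
Qed.

Lemma cond_exp_vec_pull_out (G : set (set T)) (X Y phi : T -> 'rV[R]_d) (K : R) :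
  sigma_algebra [set: T] G -> G `<=` measurable ->
  (forall i, integ (fun w => X w 0 i)) -> is_cond_exp_vec P G X Y ->
  measurable_vec_wrt G phi -> (forall w, enorm (phi w) <= K) ->
  \int[P]_w edot (phi w) (Y w) = \int[P]_w edot (phi w) (X w).
Proof.
move=> sG Gm iX XY mphi phiK.
have mphi' i := measurable_wrt_measurable sG Gm (mphi i).
have phiK' i w : `|phi w 0 i| <= K.
  exact: le_trans (coord_le_enorm _ _) (phiK w).
rewrite !Rintegral_sum.
- apply: eq_bigr => i _.
  exact: (@cond_exp_pull_out _ _ _ _ G _ _ _ K).
- by move=> i; exact: (@integrable_bounded_mul _ _ _ _ K).
- move=> i; apply: (@integrable_bounded_mul _ _ _ _ K) => //.
  by case: (XY i).
Qed.

(* At level [n] the grid points are indexed by [j <= 2 ^ n]; point [j] of level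
   [n] is point [j.*2] of level [n.+1]. [V n j] is the prediction of the value at
   point [j.+1] from what is known at point [j]. *)
Variables (G : nat -> nat -> set (set T)) (U V : nat -> nat -> T -> 'rV[R]_d).
Variable Z : nat -> T -> R.
Hypothesis G_sigma : forall n j, (j <= 2 ^ n)%N -> sigma_algebra [set: T] (G n j).
Hypothesis G_measurable : forall n j, (j <= 2 ^ n)%N -> G n j `<=` measurable.
Hypothesis G_succ : forall n j, (j < 2 ^ n)%N -> G n j `<=` G n j.+1.
Hypothesis G_double : forall n j, G n.+1 j.*2 = G n j.
Hypothesis U_double : forall n j, U n.+1 j.*2 = U n j.
Hypothesis U_int : forall n j i, (j <= 2 ^ n)%N -> integ (fun w => U n j w 0 i).
Hypothesis V_cond : forall n j, (j < 2 ^ n)%N ->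
  is_cond_exp_vec P (G n j) (U n j.+1) (V n j).
Hypothesis Z_int : forall n, integ (Z n).
Hypothesis VU_le : forall n j w, (j < 2 ^ n)%N ->
  enorm (V n j w - U n j w) <= Z n w.

Let Z_ge0 n w : 0 <= Z n w.
Proof. by rewrite (le_trans _ (@VU_le n 0 w _)) ?enorm_ge0// expn_gt0. Qed.

(** A multiplier known at point [j] does not distinguish the value at point
    [j.+1] from its prediction [V n j], and the prediction is within [Z n] of the
    present value. *)
Lemma dyadic_step n j (phi : T -> 'rV[R]_d) K : (j < 2 ^ n)%N ->
  measurable_vec_wrt (G n j) phi -> (forall w, enorm (phi w) <= K) ->
  \int[P]_w edot (phi w) (U n j w) <=
  \int[P]_w edot (phi w) (U n j.+1 w) + \int[P]_w (enorm (phi w) * Z n w).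
Proof.
move=> jn mphi phiK; have jn' := ltnW jn.
have mphi' i := measurable_wrt_measurable (G_sigma jn') (G_measurable jn') (mphi i).
have iV i : integ (fun w => V n j w 0 i) by case: (V_cond jn i).
have iphiV := integrable_edot mphi' phiK iV.
have iphiU := integrable_edot mphi' phiK (fun i => U_int i jn').
have iphiZ := integrable_enorm_mul mphi' phiK (Z_int n).
rewrite -(cond_exp_vec_pull_out (G_sigma jn') (G_measurable jn')
  (fun i => U_int i jn) (V_cond jn) mphi phiK).
rewrite -RintegralD//; apply: le_Rintegral => //; first exact: integrableD_fun.
move=> w _.
(* Cauchy-Schwarz is applied to [- phi], as [U] is to be bounded by [V]. *)
have := edot_le (- phi w) (V n j w - U n j w).
rewrite edotBr -scaleN1r enormZ normrN1 mul1r.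
have edotN x : edot (-1 *: phi w) x = - edot (phi w) x.
  by rewrite /edot -sumrN; apply: eq_bigr => i _; rewrite !mxE mulN1r mulNr.
rewrite !edotN => H.
have : enorm (phi w) * enorm (V n j w - U n j w) <= enorm (phi w) * Z n w.
  by rewrite ler_wpM2l ?enorm_ge0// VU_le.
by move: H; lra.
Qed.

Definition chain_bound n w := enorm (U 0 1 w) + \sum_(k < n.+1) Z k w.

Lemma integrable_chain_bound n :
  integ (fun w => enorm (U 0 1 w)) -> integ (chain_bound n).
Proof.
by move=> iU; apply: integrableD_fun => //; apply: integrable_sum_fun.
Qed.

Hypothesis U01_int : integ (fun w => enorm (U 0 1 w)).

(** By induction on the level: an even point lives on the coarser level, an odd
    one reaches such a point in one step, at the cost [Z n]. The multiplier stays
    admissible because the sigma-algebras grow along the way. *)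
Lemma dyadic_chain n j (phi : T -> 'rV[R]_d) K : (j <= 2 ^ n)%N ->
  measurable_vec_wrt (G n j) phi -> (forall w, enorm (phi w) <= K) ->
  \int[P]_w edot (phi w) (U n j w) <=
  \int[P]_w (enorm (phi w) * chain_bound n w).
Proof.
have mG m i (psi : T -> 'rV[R]_d) k : (i <= 2 ^ m)%N -> measurable_vec_wrt (G m i) psi ->
    measurable_fun [set: T] (fun w => psi w 0 k).
  move=> im mpsi; exact: (measurable_wrt_measurable (G_sigma im)
    (@G_measurable _ _ im) (mpsi k)).
elim: n j => [|n IH] j jn mphi phiK.
  have mphi' k := mG _ _ phi k jn mphi.
  have iphiZ := integrable_enorm_mul mphi' phiK (Z_int 0).
  have last_le : \int[P]_w edot (phi w) (U 0 1 w) <=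
      \int[P]_w (enorm (phi w) * enorm (U 0 1 w)).
    apply: le_Rintegral => //; last by move=> w _; exact: edot_le.
      by apply: integrable_edot mphi' phiK _ => i; exact: U_int.
    exact: integrable_enorm_mul mphi' phiK _.
  have -> : \int[P]_w (enorm (phi w) * chain_bound 0 w) =
      \int[P]_w (enorm (phi w) * enorm (U 0 1 w)) +
      \int[P]_w (enorm (phi w) * Z 0 w).
    rewrite -RintegralD//; last exact: integrable_enorm_mul mphi' phiK _.
    by apply: eq_Rintegral => w _; rewrite /chain_bound big_ord1 mulrDr.
  case: j jn mphi => [|[|//]] jn mphi.
    apply: le_trans (dyadic_step _ mphi phiK) _ => //.
    by rewrite lerD2r.
  rewrite -[leLHS]addr0 lerD// Rintegral_ge0// => w _.
  by rewrite mulr_ge0// enorm_ge0.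
have mphi' k := mG _ _ phi k jn mphi.
have iphiZ := integrable_enorm_mul mphi' phiK (Z_int n.+1).
have iphiW := integrable_enorm_mul mphi' phiK (integrable_chain_bound n U01_int).
have -> : \int[P]_w (enorm (phi w) * chain_bound n.+1 w) =
    \int[P]_w (enorm (phi w) * chain_bound n w) +
    \int[P]_w (enorm (phi w) * Z n.+1 w).
  rewrite -RintegralD//; apply: eq_Rintegral => w _.
  by rewrite /chain_bound [in LHS]big_ord_recr/= addrA mulrDr.
have even_case i : (i <= 2 ^ n)%N -> measurable_vec_wrt (G n.+1 i.*2) phi ->
    \int[P]_w edot (phi w) (U n.+1 i.*2 w) <=
    \int[P]_w (enorm (phi w) * chain_bound n w).
  by rewrite G_double U_double => iN mphi2; exact: IH.
have [jodd|jeven] := boolP (odd j); last first.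
  have jE : j = j./2.*2 by rewrite -[LHS]odd_double_half (negbTE jeven).
  rewrite -[leLHS]addr0 lerD//; last first.
    by apply: Rintegral_ge0 => w _; rewrite mulr_ge0// enorm_ge0.
  rewrite jE; apply: even_case; last by rewrite -jE.
  by rewrite leq_half_double expnS mul2n in jn *; lia.
have jE : j.+1 = j./2.+1.*2 by rewrite doubleS -[in LHS](odd_double_half j) jodd.
have jlt : (j < 2 ^ n.+1)%N.
  rewrite ltn_neqAle jn andbT; apply: contraL jodd => /eqP ->.
  by rewrite oddX.
apply: le_trans (dyadic_step jlt mphi phiK) _.
rewrite lerD2r jE; apply: even_case; last first.
  by rewrite -jE => k; exact: measurable_wrt_sub (G_succ jlt) (mphi k).
by move: jlt; rewrite expnS mul2n -[j in (j < _)%N]odd_double_half jodd; lia.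
Qed.

End dyadic_chaining.

(** * Doob's maximal inequality from a chaining estimate *)

Section doob_maximal.
Context (R : realType).
Implicit Types (K q a b : R) (x : nat -> R).

(** Truncating at [K] makes the maximum have finite norms and keeps the
    multipliers built from it bounded. Starting from 0 makes the first value
    count as an increment like the others. *)
Fixpoint trunc_max K x (J : nat) : R :=
  if J is j.+1 then Num.max (trunc_max K x j) (Num.min K (x j)) else 0.

Lemma trunc_max_ge0 K x J : 0 <= trunc_max K x J.
Proof. by elim: J => //= J IH; rewrite le_max IH. Qed.

Lemma trunc_max_lub K x J c : 0 <= c ->
  (forall j, (j < J)%N -> Num.min K (x j) <= c) -> trunc_max K x J <= c.
Proof.
move=> c0; elim: J => //= J IH xc; rewrite ge_max xc// andbT.
by apply: IH => j jJ; apply: xc; exact: ltnW.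
Qed.

Lemma trunc_max_ub K x J j : (j < J)%N -> Num.min K (x j) <= trunc_max K x J.
Proof.
elim: J => //= J IH; rewrite ltnS leq_eqVlt => /predU1P[->|/IH xJ].
  by rewrite le_max lexx orbT.
by rewrite le_max xJ.
Qed.

Lemma trunc_maxS K x J :
  trunc_max K x J.+1 = Num.max (trunc_max K x J) (Num.min K (x J)).
Proof. by []. Qed.

Arguments trunc_max : simpl never.

Lemma trunc_max_leS K x J : trunc_max K x J <= trunc_max K x J.+1.
Proof. by rewrite trunc_maxS le_max lexx. Qed.

Lemma trunc_max_le K x J : 0 <= K -> trunc_max K x J <= K.
Proof. by move=> K0; apply: trunc_max_lub => // j _; rewrite ge_min lexx. Qed.

Lemma trunc_max_incr K x J : trunc_max K x J < trunc_max K x J.+1 ->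
  trunc_max K x J.+1 <= x J.
Proof.
by rewrite trunc_maxS lt_max ltxx/= => lt; rewrite max_r ?ge_min ?lexx ?orbT// ltW.
Qed.

Lemma conjugate_exponent q : 1 < q -> (q / (q - 1))^-1 = 1 - q^-1.
Proof. by move=> q1; rewrite invf_div mulrBl divff ?gt_eqF ?mul1r// (lt_trans _ q1). Qed.

(** After expansion, this is Young's inequality for [a `^ (q - 1)] and [b], with
    exponents [q / (q - 1)] and [q]. *)
Lemma powR_incr_le q a b : 1 < q -> 0 <= a -> a <= b ->
  (1 - q^-1) * (b `^ q - a `^ q) <= (b `^ (q - 1) - a `^ (q - 1)) * b.
Proof.
move=> q1 a0 ab; have b0 := le_trans a0 ab; have q0 : 0 < q by apply: lt_trans q1.
have qN1 : 0 < q - 1 by rewrite subr_gt0.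
have pq : (q / (q - 1))^-1 + q^-1 = 1.
  by rewrite conjugate_exponent// subrK.
have := conjugate_powR (powR_ge0 a (q - 1)) b0 (divr_gt0 q0 qN1) q0 pq.
rewrite -powRrM mulrCA divff ?gt_eqF// mulr1.
rewrite conjugate_exponent//.
rewrite [(b `^ (q - 1) - _) * b]mulrBl [b `^ (q - 1) * b]mulrC mulr_powRB1// => H.
by move: H; lra.
Qed.

(** Summation by parts of the powers of the maximum plays the role of the
    integral over levels in Doob's argument. Replacing the new maximum by [x j]
    in a term is legitimate since the weight vanishes unless [x j] has just
    exceeded the old maximum. *)
Lemma trunc_max_powR_le K q x J : 1 < q ->
  (1 - q^-1) * trunc_max K x J `^ q <=
  \sum_(j < J) (trunc_max K x j.+1 `^ (q - 1) - trunc_max K x j `^ (q - 1)) * x j.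
Proof.
move=> q1; elim: J => [|J IH].
  rewrite big_ord0 powR0 ?mulr0//.
  by rewrite gt_eqF// (lt_trans _ q1).
rewrite big_ord_recr/= -[X in _ * X](subrK (trunc_max K x J `^ q)) mulrDr addrC.
apply: lerD => //; have ab := trunc_max_leS K x J.
have b0 := trunc_max_ge0 K x J.+1; have a0 := trunc_max_ge0 K x J.
apply: le_trans (powR_incr_le q1 a0 ab) _.
have := @trunc_max_incr K x J; move: ab a0 b0.
move: (trunc_max K x J.+1) (trunc_max K x J) => b a ab a0 b0 bx.
have [->|nab] := eqVneq a b; first by rewrite subrr !mul0r.
apply: ler_wpM2l; last by apply: bx; rewrite lt_neqAle nab.
by rewrite subr_ge0 ge0_ler_powR ?subr_ge0 ?(ltW q1).
Qed.

Section probability.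
Context (disp : measure_display) (T : measurableType disp).
Context (P : probability T R) (d : nat).

Local Notation integ f := (P.-integrable [set: T] (EFin \o f)).

Lemma ge0_LnormE (r : R) (f : T -> R) : (forall w, 0 <= f w) ->
  ('N[P]_r%:E[EFin \o f] = (\int[P]_w (f w `^ r)%:E) `^ r^-1)%E.
Proof.
move=> f0; rewrite unlock; congr (_ `^ _)%E.
by apply: eq_integral => w _; rewrite /= ger0_norm.
Qed.

Lemma measurable_trunc_max d' (T' : measurableType d') K (x : nat -> T' -> R) J :
  (forall j, (j < J)%N -> measurable_fun [set: T'] (x j)) ->
  measurable_fun [set: T'] (fun w => trunc_max K (x^~ w) J).
Proof.
elim: J => [_|J IH mx]; first exact: measurable_cst.
under [X in measurable_fun _ X]eq_fun do rewrite trunc_maxS.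
apply: measurable_maxr; first by apply: IH => j jJ; apply: mx; exact: ltnW.
by apply: measurable_minr => //; exact: mx.
Qed.

Variables (H : nat -> set (set T)) (X : nat -> T -> 'rV[R]_d) (W : T -> R).
Variables (K q : R) (J : nat).
Hypothesis K_ge0 : 0 <= K.
Hypothesis q_gt1 : 1 < q.
Hypothesis H_sigma : forall j, (j < J)%N -> sigma_algebra [set: T] (H j).
Hypothesis H_measurable : forall j, (j < J)%N -> H j `<=` measurable.
Hypothesis H_mono : forall i j, (i <= j < J)%N -> H i `<=` H j.
Hypothesis X_adapted : forall j, (j < J)%N -> measurable_vec_wrt (H j) (X j).
Hypothesis X_int : forall j i, (j < J)%N -> integ (fun w => X j w 0 i).
Hypothesis W_int : integ W.
Hypothesis W_ge0 : forall w, 0 <= W w.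
Hypothesis X_le_W : forall j (phi : T -> 'rV[R]_d) C, (j < J)%N ->
  measurable_vec_wrt (H j) phi -> (forall w, enorm (phi w) <= C) ->
  \int[P]_w edot (phi w) (X j w) <= \int[P]_w (enorm (phi w) * W w).

Let M j w := trunc_max K (fun j => enorm (X j w)) j.

Let M_ge0 j w : 0 <= M j w.
Proof. exact: trunc_max_ge0. Qed.

Let M_le j w : M j w <= K.
Proof. exact: trunc_max_le. Qed.

Let Mpow_le j w (r : R) : 0 <= r -> `|M j w `^ r| <= K `^ r.
Proof. by move=> r0; rewrite ger0_norm ?powR_ge0// ge0_ler_powR// nnegrE. Qed.

Let enorm_wrt i j : (i <= j < J)%N -> measurable_wrt (H j) (fun w => enorm (X i w)).
Proof.
move=> /[dup] ij /andP[ij' jJ]; apply: (@measurable_enorm _ _ _ (g_sigma_algebraType (H j))) => k.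
exact: measurable_wrt_sub (H_mono ij) (X_adapted (leq_ltn_trans ij' jJ) k).
Qed.

Let measurable_M j : (j <= J)%N -> measurable_fun [set: T] (M j).
Proof.
move=> jJ; apply: measurable_trunc_max => i ij; have iJ := leq_trans ij jJ.
apply: (measurable_wrt_measurable (H_sigma iJ) (@H_measurable _ iJ)).
by apply: enorm_wrt; rewrite leqnn.
Qed.

Let measurable_powR_comp d' (T' : measurableType d') (f : T' -> R) r :
  measurable_fun [set: T'] f -> measurable_fun [set: T'] (fun w => f w `^ r).
Proof. by move=> mf; exact: (@measurableT_comp _ _ _ _ _ _ (@powR R ^~ r)). Qed.

Let a j w := M j.+1 w `^ (q - 1) - M j w `^ (q - 1).

Let qN1_ge0 : 0 <= q - 1.
Proof. by rewrite subr_ge0 ltW. Qed.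

Let a_ge0 j w : 0 <= a j w.
Proof.
by rewrite subr_ge0 ge0_ler_powR ?nnegrE//; exact: trunc_max_leS.
Qed.

Let a_le j w : a j w <= K `^ (q - 1).
Proof.
rewrite lerBlDr -[leLHS]addr0 lerD ?powR_ge0//.
by rewrite ge0_ler_powR ?nnegrE.
Qed.

(* The weight times the unit vector along [X j w]; where [X j w] vanishes the
   quotient is 0, which agrees with the pairing wanted in [edot_phi]. *)
Let phi j w : 'rV[R]_d := (a j w * (enorm (X j w))^-1) *: X j w.

Let enorm_phi j w : enorm (phi j w) <= a j w.
Proof.
rewrite enormZ normrM normfV (ger0_norm (a_ge0 _ _)) (ger0_norm (enorm_ge0 _)).
have [->|X0] := eqVneq (enorm (X j w)) 0; first by rewrite mulr0.
by rewrite divfK.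
Qed.

Let edot_phi j w : edot (phi j w) (X j w) = a j w * enorm (X j w).
Proof.
have -> : edot (phi j w) (X j w) = (a j w * (enorm (X j w))^-1) * edot (X j w) (X j w).
  by rewrite /edot mulr_sumr; apply: eq_bigr => i _; rewrite mxE mulrA.
rewrite edotxx; have [->|X0] := eqVneq (enorm (X j w)) 0.
  by rewrite expr0n/= !mulr0.
by rewrite expr2 mulrA divfK.
Qed.

Let a_wrt j : (j < J)%N -> measurable_wrt (H j) (a j).
Proof.
move=> jJ; apply: measurable_funB; apply: measurable_powR_comp;
  apply: measurable_trunc_max => i ij; apply: enorm_wrt; rewrite jJ andbT//.
exact: ltnW.
Qed.

Let phi_wrt j : (j < J)%N -> measurable_vec_wrt (H j) (phi j).
Proof.
move=> jJ i; rewrite /phi; under eq_fun do rewrite mxE.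
apply: measurable_funM; last exact: X_adapted.
apply: measurable_funM; first exact: a_wrt.
(* The inverse is the power of exponent -1, also at 0. *)
under eq_fun do rewrite -powR_inv1 ?enorm_ge0//.
by apply: measurable_powR_comp; apply: enorm_wrt; rewrite leqnn.
Qed.

Let M_pow_int (r : R) : 0 <= r -> integ (fun w => M J w `^ r).
Proof.
move=> r0; apply: measurable_bounded_integrable => //.
- by apply: le_lt_trans (probability_le1 P measurableT) _; rewrite ltry.
- by apply: measurable_powR_comp; exact: measurable_M.
- exists (K `^ r); split => // y Ky w _.
  exact: le_trans (Mpow_le _ _ r0) (ltW Ky).
Qed.

Let MW_int : integ (fun w => M J w `^ (q - 1) * W w).
Proof.
apply: (@integrable_bounded_mul _ _ _ _ (K `^ (q - 1))) => //.
- by apply: measurable_powR_comp; exact: measurable_M.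
- by move=> w; exact: Mpow_le.
Qed.

(** The pathwise inequality is integrated term by term; each term is the pairing
    of [X j] with [phi j], to which the hypothesis on multipliers applies, and
    the weights then telescope to the last power of the maximum. *)
Lemma doob_power_inequality :
  (1 - q^-1) * \int[P]_w (M J w `^ q) <= \int[P]_w (M J w `^ (q - 1) * W w).
Proof.
have a_meas (j : 'I_J) : measurable_fun [set: T] (a j).
  have jJ := ltn_ord j.
  exact: (measurable_wrt_measurable (H_sigma jJ) (@H_measurable _ jJ) (a_wrt jJ)).
have a_norm j w : `|a j w| <= K `^ (q - 1) by rewrite ger0_norm.
have q0 : 0 <= q by rewrite (le_trans _ (ltW q_gt1)).
have phiK j w : enorm (phi j w) <= K `^ (q - 1).
  exact: le_trans (enorm_phi _ _) (a_le _ _).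
have phi_meas (j : 'I_J) i : measurable_fun [set: T] (fun w => phi j w 0 i).
  have jJ := ltn_ord j.
  exact: (measurable_wrt_measurable (H_sigma jJ) (@H_measurable _ jJ) (phi_wrt jJ i)).
have phiX_int (j : 'I_J) : integ (fun w => edot (phi j w) (X j w)).
  by apply: (integrable_edot (phi_meas j) (phiK j)) => i; exact: X_int.
have phiW_int (j : 'I_J) := integrable_enorm_mul (phi_meas j) (phiK j) W_int.
have aW_int (j : 'I_J) : integ (fun w => a j w * W w).
  exact: (@integrable_bounded_mul _ _ _ _ (K `^ (q - 1))).
rewrite -RintegralZl//; last exact: M_pow_int.
apply: (@le_trans _ _ (\int[P]_w \sum_(j < J) edot (phi j w) (X j w))).
  apply: le_Rintegral => //.
  - exact: (integrableZl measurableT _ (M_pow_int q0)).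
  - exact: integrable_sum_fun.
  - move=> w _; under eq_bigr do rewrite edot_phi.
    exact: (trunc_max_powR_le K (fun j => enorm (X j w)) J q_gt1).
rewrite Rintegral_sum//.
apply: (@le_trans _ _ (\sum_(j < J) \int[P]_w (a j w * W w))).
  apply: ler_sum => j _.
  apply: le_trans (X_le_W (ltn_ord j) (phi_wrt (ltn_ord j)) (phiK j)) _.
  apply: le_Rintegral => // w _.
  by rewrite ler_wpM2r.
rewrite -Rintegral_sum//; apply: le_Rintegral => //.
  exact: integrable_sum_fun.
move=> w _; rewrite -mulr_suml ler_wpM2r//.
rewrite -(big_mkord xpredT (fun j => a j w)) telescope_sumr//.
by rewrite lerBlDr -[leLHS]addr0 lerD// powR_ge0.
Qed.

(** Hoelder's inequality for [M `^ (q - 1)] and [W] bounds the [q]-th power of the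
    norm of [M] by [q / (q - 1)] times its [(q - 1)]-th power times the norm of
    [W]; truncation makes the norm of [M] finite, so that one may divide. *)
Lemma doob_Lq_inequality :
  ('N[P]_q%:E[EFin \o M J] <= (q / (q - 1))%:E * 'N[P]_q%:E[EFin \o W])%E.
Proof.
have q0 : 0 < q by rewrite (lt_trans _ q_gt1).
have qN1 : 0 < q - 1 by rewrite subr_gt0.
have conj0 : 0 < q / (q - 1) by rewrite divr_gt0.
have pq : (q / (q - 1))^-1 + q^-1 = 1.
  by rewrite conjugate_exponent// subrK.
set I := \int[P]_w (M J w `^ q).
have I0 : 0 <= I by apply: Rintegral_ge0 => w _; exact: powR_ge0.
have IE : (\int[P]_w (M J w `^ q)%:E = I%:E)%E.
  by rewrite fineK//; apply: integrable_fin_num => //; apply: M_pow_int; exact: ltW.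
have NM : ('N[P]_q%:E[EFin \o M J] = (I `^ q^-1)%:E)%E.
  by rewrite ge0_LnormE// IE.
have NMc : ('N[P]_(q / (q - 1))%:E[EFin \o (fun w => M J w `^ (q - 1))%R] =
    (I `^ (1 - q^-1))%:E)%E.
  rewrite ge0_LnormE; last by move=> w; exact: powR_ge0.
  under eq_integral do rewrite -powRrM mulrCA divff ?gt_eqF// mulr1.
  by rewrite IE conjugate_exponent.
have mW : measurable_fun [set: T] W.
  by apply/measurable_EFinP; exact: measurable_int W_int.
have mMq : measurable_fun [set: T] (fun w => M J w `^ (q - 1)).
  by apply: measurable_powR_comp; exact: measurable_M.
have := hoelder P mMq mW conj0 q0 pq.
rewrite Lnorm1 NMc NM.
have -> : (\int[P]_x `|(EFin \o ((fun w : T => M J w `^ (q - 1)) \* W)%R) x| =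
   (\int[P]_w (M J w `^ (q - 1) * W w))%R%:E)%E.
  rewrite /Rintegral fineK; last exact: integrable_fin_num.
  by apply: eq_integral => w _; rewrite /= ger0_norm ?mulr_ge0 ?powR_ge0.
have := doob_power_inequality; rewrite -/I.
have : (0 <= 'N[P]_q%:E[EFin \o W])%E by exact: Lnorm_ge0.
case: ('N[P]_q%:E[EFin \o W])%E => [c| |//]; last first.
  by move=> _ _ _; rewrite gt0_muley ?leey// lte_fin.
rewrite !lee_fin => c0 le1 le2; have {le1 le2} le12 := le_trans le1 le2.
have [I_eq0|I_neq0] := eqVneq I 0.
  by rewrite I_eq0 powR0 ?invr_neq0 ?gt_eqF// mulr_ge0// ltW.
have I_gt0 : 0 < I by rewrite lt_def I_neq0.
have Is : I = I `^ q^-1 * I `^ (1 - q^-1).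
  by rewrite -powRD ?I_neq0 ?implybT// addrC subrK powRr1.
have Ic0 : 0 < I `^ (1 - q^-1) by rewrite powR_gt0.
rewrite -(ler_pM2r Ic0) -Is.
rewrite -(ler_pM2l (_ : 0 < 1 - q^-1)); last by rewrite -conjugate_exponent// invr_gt0.
have -> : (1 - q^-1) * ((q / (q - 1)) * c * I `^ (1 - q^-1)) = I `^ (1 - q^-1) * c.
  by field; rewrite !gt_eqF.
exact: le12.
Qed.

End probability.
End doob_maximal.

(** * Norms on a probability space *)

Section Lnorm_facts.
Context (disp : measure_display) (T : measurableType disp) (R : realType).
Variable P : probability T R.

Local Notation integ f := (P.-integrable [set: T] (EFin \o f)).

(** Hoelder's inequality for [`|f| `^ q] and the constant 1, with exponent
    [r / q]. *)
Lemma Lnorm_le_exponent (q r : R) (f : T -> R) : 0 < q -> q <= r ->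
  measurable_fun [set: T] f ->
  ('N[P]_q%:E[EFin \o f] <= 'N[P]_r%:E[EFin \o f])%E.
Proof.
move=> q0; rewrite le_eqVlt => /predU1P[->//|qr] mf.
have r0 := lt_trans q0 qr.
pose g w := `|f w| `^ q.
have g0 w : 0 <= g w by exact: powR_ge0.
have mg : measurable_fun [set: T] g.
  by apply: (@measurableT_comp _ _ _ _ _ _ (@powR R ^~ q)) => //; exact: measurableT_comp.
have s0 : 0 < r / q by rewrite divr_gt0.
have qr1 : (r / q)^-1 < 1 by rewrite invf_div ltr_pdivrMr// mul1r.
have s'0 : 0 < (1 - (r / q)^-1)^-1 by rewrite invr_gt0 subr_gt0.
have ss' : (r / q)^-1 + ((1 - (r / q)^-1)^-1)^-1 = 1 by rewrite invrK addrC subrK.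
have := hoelder P mg (measurable_cst (1 : R)) s0 s'0 ss'.
have -> : (g \* cst 1)%R = g by apply/funext => w; rewrite /= mulr1.
rewrite Lnorm_cst1.
have -> : (P [set: T] `^ (1 - (r / q)^-1) ^-1^-1 = 1)%E.
  by rewrite probability_setT poweR1r.
rewrite mule1 Lnorm1 ge0_LnormE// => H.
have NE (s : R) : ('N[P]_s%:E[EFin \o f] = (\int[P]_w (`|f w| `^ s)%:E) `^ s^-1)%E.
  rewrite -Lnorm_abse (_ : abse \o _ = EFin \o (fun w => `|f w|))//.
  by rewrite ge0_LnormE.
rewrite !NE.
have H1 : (\int[P]_w (`|f w| `^ q)%:E <= (\int[P]_w (`|f w| `^ r)%:E) `^ (q / r))%E.
  move: H; rewrite invf_div.
  under [X in (X <= _)%E -> _]eq_integral do rewrite /= ger0_norm//.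
  under [X in (_ <= X `^ _)%E -> _]eq_integral do
    rewrite /g -powRrM mulrCA divff ?gt_eqF// mulr1.
  by [].
have -> : r^-1 = q / r * q^-1 by rewrite mulrAC divff ?gt_eqF// mul1r.
rewrite poweRrM; apply: gt0_ler_poweR => //.
- by rewrite invr_ge0 ltW.
- by rewrite in_itv/= leey andbT; apply: integral_ge0 => w _; rewrite lee_fin.
- by rewrite in_itv/= leey andbT poweR_ge0.
Qed.

Lemma Lnorm_lty_integrable (r : R) (f : T -> R) : 1 <= r ->
  measurable_fun [set: T] f -> ('N[P]_r%:E[EFin \o f] < +oo)%E -> integ f.
Proof.
move=> r1 mf fr; apply/integrableP; split; first exact/measurable_EFinP.
have := Lnorm_le_exponent ltr01 r1 mf; rewrite Lnorm1 => fle.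
exact: le_lt_trans fle fr.
Qed.

Lemma Lnorm_sum_le (r : R) (f : nat -> T -> R) (m : nat) : 1 <= r ->
  (forall k, measurable_fun [set: T] (f k)) ->
  ('N[P]_r%:E[EFin \o (fun w => \sum_(k < m) f k w)%R]
    <= \sum_(k < m) 'N[P]_r%:E[EFin \o f k])%E.
Proof.
move=> r1 mf; have r0 : 0 < r by rewrite (lt_le_trans ltr01).
elim: m => [|m IH].
  rewrite big_ord0 (_ : EFin \o _ = cst 0%E).
    by rewrite Lnorm0// eqe gt_eqF.
  by apply/funext => w; rewrite /= big_ord0.
rewrite big_ord_recr/=.
rewrite (_ : EFin \o _ = EFin \o ((fun w => \sum_(k < m) f k w) \+ f m)%R).
  apply: le_trans (minkowski_EFin _ _ _ _) _ => //.
    by apply: measurable_sum.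
  exact: leeD.
by apply/funext => w; rewrite /= big_ord_recr.
Qed.

(** The pointwise l^p norm, used in place of a maximum over [j < N]: it dominates
    every entry and its [p]-th power integrates term by term. *)
Definition lp_sum (p : R) (N : nat) (xi : nat -> T -> R) w : R :=
  (\sum_(j < N) xi j w `^ p) `^ p^-1.

Section lp_sum.
Variables (p c : R) (N : nat) (xi : nat -> T -> R).
Hypothesis p_gt0 : 0 < p.
Hypothesis xi_ge0 : forall j w, 0 <= xi j w.

Lemma le_lp_sum j w : (j < N)%N -> xi j w <= lp_sum p N xi w.
Proof.
move=> jN; have pp : p * p^-1 = 1 by rewrite divff// gt_eqF.
rewrite -[leLHS]powRr1// -pp powRrM.
rewrite ge0_ler_powR ?nnegrE ?invr_ge0 ?powR_ge0 ?sumr_ge0//; first exact: ltW.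
  by move=> i _; exact: powR_ge0.
rewrite (bigD1 (Ordinal jN))//= lerDl sumr_ge0// => i _; exact: powR_ge0.
Qed.

Lemma lp_sum_ge0 w : 0 <= lp_sum p N xi w.
Proof. exact: powR_ge0. Qed.

Hypothesis xi_meas : forall j, (j < N)%N -> measurable_fun [set: T] (xi j).

Let xip_meas (j : 'I_N) : measurable_fun [set: T] (fun w => xi j w `^ p).
Proof.
by apply: (@measurableT_comp _ _ _ _ _ _ (@powR R ^~ p)) => //; exact: xi_meas.
Qed.

Lemma measurable_lp_sum : measurable_fun [set: T] (lp_sum p N xi).
Proof.
apply: (@measurableT_comp _ _ _ _ _ _ (@powR R ^~ p^-1)) => //.
exact: (@measurable_sum _ _ _ _ _ _ (fun (j : 'I_N) w => xi j w `^ p)).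
Qed.

Lemma Lnorm_lp_sum :
  (forall j, (j < N)%N -> (\int[P]_w (xi j w `^ p)%:E <= c%:E)%E) ->
  ('N[P]_p%:E[EFin \o lp_sum p N xi] <= ((N%:R * c) `^ p^-1)%:E)%E.
Proof.
move=> xic; rewrite ge0_LnormE; last exact: lp_sum_ge0.
rewrite -poweR_EFin.
have H : (\int[P]_w (lp_sum p N xi w `^ p)%:E <= (N%:R * c)%:E)%E.
  under eq_integral => w _.
    rewrite /lp_sum -powRrM mulVf ?gt_eqF// powRr1; last first.
      by apply: sumr_ge0 => j _; exact: powR_ge0.
    rewrite -sumEFin; over.
  rewrite ge0_integral_sum//=; [|by move=> j; exact/measurable_EFinP|]; last first.
    by move=> j w _; rewrite lee_fin powR_ge0.
  apply: (@le_trans _ _ (\sum_(j < N) c%:E)%E); first by apply: lee_sum => j _; exact: xic.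
  by rewrite sumEFin lee_fin sumr_const card_ord mulr_natl.
have I0 : (0 <= \int[P]_w (lp_sum p N xi w `^ p)%:E)%E.
  by apply: integral_ge0 => w _; rewrite lee_fin powR_ge0.
apply: gt0_ler_poweR => //.
- by rewrite invr_ge0 ltW.
- by rewrite in_itv/= leey I0.
- by rewrite in_itv/= leey (le_trans I0 H).
Qed.

End lp_sum.

Import HBNNSimple.

(** The integral of a nonnegative function is a supremum over the simple
    functions below it, so the smaller function may be arbitrary. This serves
    for a supremum over uncountably many times. *)
Lemma ae_le_integral_nonmeasurable (f g : T -> \bar R) :
  (forall w, 0 <= f w)%E -> (forall w, 0 <= g w)%E ->
  measurable_fun [set: T] g -> {ae P, forall w, (f w <= g w)%E} ->
  (\int[P]_w f w <= \int[P]_w g w)%E.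
Proof.
move=> f0 g0 mg fg; rewrite [leLHS]ge0_integralTE//.
apply: ge_ereal_sup => _ [h /= hf <-]; rewrite -integralT_nnsfun.
apply: ae_ge0_le_integral => //.
- by move=> w _; rewrite lee_fin fun_ge0.
- by apply/measurable_EFinP; exact: measurable_funPT.
- by apply: filterS fg => w fgw _; exact: le_trans (hf w) fgw.
Qed.

End Lnorm_facts.

(** * The dyadic grid *)

Section dyadic_grid.
Context (R : realType).
Implicit Types s L : R.

Definition dyadic s L (n j : nat) : R := s + L * (j%:R / 2 ^+ n).

Lemma dyadic_double s L n j : dyadic s L n.+1 j.*2 = dyadic s L n j.
Proof.
rewrite /dyadic -muln2 natrM exprS; congr (_ + _ * _).
by field; rewrite expf_neq0.
Qed.

Lemma dyadic_last s L n : dyadic s L n (2 ^ n) = s + L.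
Proof. by rewrite /dyadic natrX divff ?mulr1// expf_neq0. Qed.

Lemma dyadic_mono s L n i j : 0 <= L -> (i <= j)%N ->
  dyadic s L n i <= dyadic s L n j.
Proof. by move=> L0 ij; rewrite lerD2l ler_wpM2l// ler_pM2r ?ler_nat// invr_gt0 exprn_gt0. Qed.

Lemma dyadic_itv s L n j : 0 <= L -> (j <= 2 ^ n)%N ->
  s <= dyadic s L n j <= s + L.
Proof.
move=> L0 jn; rewrite -[X in _ <= _ <= X](dyadic_last s L n) dyadic_mono// andbT.
by rewrite lerDl mulr_ge0// divr_ge0// exprn_ge0.
Qed.

Lemma dyadicB s L n j : dyadic s L n j.+1 - dyadic s L n j = L / 2 ^+ n.
Proof. by rewrite /dyadic -natr1; field; rewrite expf_neq0. Qed.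

(** Take the grid point just below [u] on a level whose mesh is less than [e];
    asking for arbitrarily fine levels leaves room for a large truncation. *)
Lemma dyadic_dense s L u e (N : nat) : 0 < L -> 0 < e -> s <= u <= s + L ->
  exists n j, [/\ (N <= n)%N, (j <= 2 ^ n)%N & `|u - dyadic s L n j| < e].
Proof.
move=> L0 e0 /andP[su usL].
pose n := maxn N (Num.truncn (L / e)); pose z := (u - s) / L * 2 ^+ n.
have p2 : 0 < 2 ^+ n :> R by rewrite exprn_gt0.
have z0 : 0 <= z by rewrite mulr_ge0 ?divr_ge0 ?subr_ge0// ltW.
have /andP[jz zj] := truncn_itv z0.
have zle : z <= 2 ^+ n by rewrite ler_piMl ?(ltW p2)// ler_pdivrMr// mul1r lerBlDl.
exists n, (Num.truncn z); split; first exact: leq_maxl.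
  by rewrite -(ler_nat R) natrX (le_trans jz).
have -> : u - dyadic s L n (Num.truncn z) = L / 2 ^+ n * (z - (Num.truncn z)%:R).
  by rewrite /dyadic {2}/z; field; rewrite !gt_eqF.
rewrite ger0_norm; last by rewrite mulr_ge0 ?subr_ge0// divr_ge0 ?ltW.
apply: (@le_lt_trans _ _ (L / 2 ^+ n)).
  rewrite ler_piMr ?divr_ge0 ?(ltW L0) ?(ltW p2)// lerBlDr.
  by rewrite addrC natr1 ltW.
rewrite ltr_pdivrMr// mulrC -ltr_pdivrMr//.
apply: (lt_le_trans (truncnS_gt _)); rewrite -natrX ler_nat.
apply: leq_trans (ltn_expl n (leqnn 2)).
by rewrite ltnS leq_maxr.
Qed.

End dyadic_grid.

(** * The maximal inequality on a grid *)

Section maximal_inequality.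
Context (R : realType) (p h : R).
Hypotheses (p_gt1 : 1 < p) (ph_gt1 : 1 < p * h).

Let p_gt0 : 0 < p. Proof. exact: lt_trans p_gt1. Qed.

(** The ratio [2 `^ (p^-1 - h)] between the bounds of successive levels. *)
Definition chain_ratio : R := 2 `^ ((1 - p * h) / p).

Lemma chain_ratio_ge0 : 0 <= chain_ratio.
Proof. exact: powR_ge0. Qed.

Lemma chain_ratio_lt1 : chain_ratio < 1.
Proof.
rewrite /chain_ratio /powR pnatr_eq0/= expR_lt1 pmulr_llt0 ?ln_gt0 ?ltr1n//.
by rewrite pmulr_llt0 ?invr_gt0// subr_lt0.
Qed.

Definition chain_const : R := (1 - chain_ratio)^-1 `^ p.

Lemma chain_const_gt0 : 0 < chain_const.
Proof. by rewrite powR_gt0// invr_gt0 subr_gt0 chain_ratio_lt1. Qed.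

Lemma chain_const_root : chain_const `^ p^-1 = (1 - chain_ratio)^-1.
Proof.
rewrite /chain_const -powRrM divff ?gt_eqF// powRr1// invr_ge0 subr_ge0.
exact: ltW chain_ratio_lt1.
Qed.

Lemma geometric_chain_le m :
  \sum_(k < m) chain_ratio ^+ k <= (1 - chain_ratio)^-1.
Proof.
have r1 : 0 < 1 - chain_ratio by rewrite subr_gt0 chain_ratio_lt1.
rewrite -(ler_pM2l r1) divff ?gt_eqF// -opprB mulNr -subrX1 opprB.
by rewrite lerBlDr lerDl exprn_ge0// chain_ratio_ge0.
Qed.

(** Level [n] consists of [2 ^ n] intervals of length [L / 2 ^+ n], each of which
    contributes [A] times the power [p * h] of that length. *)
Lemma level_boundE (A L : R) (n : nat) : 0 <= A -> 0 <= L ->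
  ((2 ^ n)%:R * (A * (L / 2 ^+ n) `^ (p * h))) `^ p^-1 =
  A `^ p^-1 * L `^ h * chain_ratio ^+ n.
Proof.
move=> A0 L0; have p2 : 0 < 2 ^+ n :> R by rewrite exprn_gt0.
have p2' : 0 <= 2 ^+ n :> R by exact: ltW.
rewrite natrX (@powRM _ L) ?invr_ge0//.
rewrite mulrCA [2 ^+ n * _]mulrCA mulrA.
have -> : 2 ^+ n * (2 ^+ n)^-1 `^ (p * h) = (2 ^+ n) `^ (1 - p * h).
  rewrite powRB ?(gt_eqF p2) ?implybT// powRr1// -powR_inv1// -powRrM mulN1r.
  by rewrite powRN.
rewrite powRM ?mulr_ge0 ?powR_ge0// powRM ?powR_ge0//.
congr (_ * _ * _).
  by rewrite -powRrM mulrAC divff ?gt_eqF// mul1r.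
rewrite -powRrM -powR_mulrn// -powRrM mulrC powRrM powR_mulrn ?powR_ge0//.
Qed.

Context (disp : measure_display) (Omega : measurableType disp).
Context (P : probability Omega R) (F : R -> set (set Omega)).
Context (d : nat) (tau A : R) (X : R -> Omega -> 'rV[R]_d).
Hypotheses (F_filt : filtration F) (A_ge0 : 0 <= A).
Hypothesis X_adapted : adapted F tau X.
Hypothesis X_control : cond_increment_control P F tau X p h A.
Variables (s0 t0 : R).
Hypotheses (s0_ge0 : 0 <= s0) (s0t0 : s0 < t0) (t0tau : t0 <= tau).
Variable q : R.
Hypotheses (q_gt1 : 1 < q) (qp : q <= p).

Local Notation integ f := (P.-integrable [set: Omega] (EFin \o f)).
Local Notation L := (t0 - s0).
Local Notation t := (dyadic s0 L).

Let L_gt0 : 0 < L. Proof. by rewrite subr_gt0. Qed.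

Let t_itv n j : (j <= 2 ^ n)%N -> s0 <= t n j <= t0.
Proof.
by move=> jn; have := dyadic_itv s0 (ltW L_gt0) jn; rewrite subrKC.
Qed.

Let t_ge0 n j : (j <= 2 ^ n)%N -> 0 <= t n j.
Proof. by move=> /t_itv/andP[+ _]; exact: le_trans. Qed.

Let t_time n j : (j <= 2 ^ n)%N -> 0 <= t n j <= tau.
Proof.
move=> jn; rewrite t_ge0//=; have /andP[_ /le_trans] := t_itv jn; exact.
Qed.

Let enorm_meas u : 0 <= u <= tau -> measurable_fun [set: Omega] (fun w => enorm (X u w)).
Proof. by move=> ut; apply: measurable_enorm; case: (X_control.1 _ ut). Qed.

Let enorm_int u : 0 <= u <= tau -> integ (fun w => enorm (X u w)).
Proof.
move=> ut; apply: (Lnorm_lty_integrable (ltW p_gt1)); first exact: enorm_meas.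
by case: (X_control.1 _ ut).
Qed.

Let coord_int u i : 0 <= u <= tau -> integ (fun w => X u w 0 i).
Proof.
move=> ut; apply: integrable_le_norm (enorm_int ut) _.
  by case: (X_control.1 _ ut).
by move=> w; exact: coord_le_enorm.
Qed.

Lemma dyadic_cond_exp : exists Y : nat -> nat -> Omega -> 'rV[R]_d,
  forall n j, (j < 2 ^ n)%N ->
    is_cond_exp_vec P (F (t n j)) (X (t n j.+1)) (Y n j) /\
    (\int[P]_w (enorm (Y n j w - X (t n j) w) `^ p)%:E
       <= (A * (L / 2 ^+ n) `^ (p * h))%:E)%E.
Proof.
have ex (nj : nat * nat) : exists Y : Omega -> 'rV[R]_d,
    (nj.2 < 2 ^ nj.1)%N ->
    is_cond_exp_vec P (F (t nj.1 nj.2)) (X (t nj.1 nj.2.+1)) Y /\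
    (\int[P]_w (enorm (Y w - X (t nj.1 nj.2) w) `^ p)%:E
       <= (A * (L / 2 ^+ nj.1) `^ (p * h))%:E)%E.
  case: nj => n j /=; have [jn|_] := boolP (j < 2 ^ n)%N; last by exists (fun=> 0).
  have step0 : 0 < L / 2 ^+ n by rewrite divr_gt0// exprn_gt0.
  have tt : t n j < t n j.+1 by rewrite -subr_gt0 dyadicB.
  have /andP[_ tS] := t_time jn.
  have [Y YX YA] := X_control.2 _ _ (t_ge0 (ltnW jn)) tt tS.
  exists Y => _; split => //; move: YA.
  by rewrite dyadicB (ger0_norm (ltW step0)) expectation.unlock.
by have [Y YP] := choice ex; exists (fun n j => Y (n, j)) => n j; exact: YP (n, j).
Qed.

(** The bound does not depend on the grid or on the truncation, since the level
    bounds form a convergent geometric series. *)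
Lemma dyadic_maximal_inequality n K : 0 <= K ->
  ('N[P]_q%:E[EFin \o
      (fun w => trunc_max K (fun j => enorm (X (t n j) w)) (2 ^ n).+1)]
   <= (q / (q - 1))%:E *
      ((chain_const `^ p^-1 * A `^ p^-1 * L `^ h)%:E + Lnorm_vec P q (X t0)))%E.
Proof.
move=> K0; have [F_sigma F_meas F_mono] := F_filt.
have [Y YP] := dyadic_cond_exp.
have q0 : 0 < q := lt_trans ltr01 q_gt1.
have mYX k j : (j < 2 ^ k)%N ->
    measurable_fun [set: Omega] (fun w => enorm (Y k j w - X (t k j) w)).
  move=> jk; apply: measurable_enorm => i; under eq_fun do rewrite !mxE.
  apply: measurable_funB; last by case: (X_control.1 _ (t_time (ltnW jk))).
  have [+ _] := YP _ _ jk => /(_ i)[_ iY _].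
  by apply/measurable_EFinP; exact: measurable_int iY.
pose xi k j w := enorm (Y k j w - X (t k j) w).
pose Z k := lp_sum p (2 ^ k) (xi k).
have xi0 k j w : 0 <= xi k j w by exact: enorm_ge0.
have mZ k : measurable_fun [set: Omega] (Z k).
  by apply: measurable_lp_sum => j jk; exact: mYX.
have ZL k : ('N[P]_p%:E[EFin \o Z k]
    <= (A `^ p^-1 * L `^ h * chain_ratio ^+ k)%:E)%E.
  rewrite -(level_boundE _ A_ge0 (ltW L_gt0)).
  apply: Lnorm_lp_sum => // [j jk|j jk]; first exact: mYX.
  by have [] := YP _ _ jk.
have Z_int k : integ (Z k).
  apply: (Lnorm_lty_integrable (ltW p_gt1)) => //.
  by rewrite (le_lt_trans (ZL k))// ltry.
pose W := chain_bound (fun n j => X (t n j)) Z n.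
have t01 : t 0 1 = t0 by rewrite -[1%N]/(2 ^ 0)%N dyadic_last subrKC.
have W_int : integ W.
  by apply: integrable_chain_bound => //; rewrite t01; apply: enorm_int;
    rewrite t0tau andbT (le_trans s0_ge0)// ltW.
have W_ge0 w : 0 <= W w.
  by rewrite addr_ge0 ?enorm_ge0// sumr_ge0// => k _; exact: lp_sum_ge0.
have step : ('N[P]_q%:E[EFin \o
    (fun w => trunc_max K (fun j => enorm (X (t n j) w)) (2 ^ n).+1)]
    <= (q / (q - 1))%:E * 'N[P]_q%:E[EFin \o W])%E.
  apply: (@doob_Lq_inequality _ _ _ P d (fun j => F (t n j)) (fun j => X (t n j))) => //.
  - by move=> j jn; apply: F_sigma; exact: t_ge0.
  - by move=> j jn; apply: F_meas; exact: t_ge0.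
  - move=> i j /andP[ij jn]; apply: F_mono.
      by apply: t_ge0; exact: leq_trans ij jn.
    by apply: dyadic_mono => //; exact: ltW.
  - by move=> j jn; apply: X_adapted; exact: t_time.
  - by move=> j i jn; apply: coord_int; exact: t_time.
  - move=> j phi C jn mphi phiC.
    apply: (@dyadic_chain _ _ _ P d (fun n j => F (t n j)) (fun n j => X (t n j)) Y Z
        _ _ _ _ _ _ _ _ _ _ n j phi C) => //.
    + by move=> m i im; apply: F_sigma; exact: t_ge0.
    + by move=> m i im; apply: F_meas; exact: t_ge0.
    + move=> m i im; apply: F_mono; first exact: t_ge0 (ltnW im).
      by apply: dyadic_mono => //; exact: ltW.
    + by move=> m i; rewrite dyadic_double.
    + by move=> m i; rewrite dyadic_double.
    + by move=> m i k im; apply: coord_int; exact: t_time.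
    + by move=> m i im; have [] := YP _ _ im.
    + by move=> m i w im; exact: (le_lp_sum p_gt0 (xi0 m)).
    + by rewrite t01; apply: enorm_int; rewrite t0tau andbT (le_trans s0_ge0)// ltW.
apply: le_trans step _; rewrite lee_pmul2l//; last first.
  by rewrite lte_fin divr_gt0// subr_gt0.
have -> : EFin \o W = EFin \o ((fun w => enorm (X t0 w)) \+
    (fun w => \sum_(k < n.+1) Z k w))%R by rewrite /W /chain_bound t01.
apply: le_trans (minkowski_EFin _ _ _ (ltW q_gt1)) _.
- by apply: enorm_meas; rewrite t0tau andbT (le_trans s0_ge0)// ltW.
- exact: measurable_sum.
rewrite addeC leeD2r//; apply: le_trans (Lnorm_sum_le P n.+1 (ltW q_gt1) mZ) _.
apply: (@le_trans _ _ (\sum_(k < n.+1) (A `^ p^-1 * L `^ h * chain_ratio ^+ k)%:E)%E).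
  by apply: lee_sum => k _; apply: le_trans (Lnorm_le_exponent P q0 qp (mZ k)) (ZL k).
rewrite sumEFin lee_fin -mulr_sumr chain_const_root -mulrA [leRHS]mulrC.
by rewrite ler_wpM2l ?mulr_ge0 ?powR_ge0// geometric_chain_le.
Qed.

End maximal_inequality.

(** * Passage to the running supremum *)

Section running_supremum.
Context (R : realType) (d : nat) (T : Type).
Variables (X : R -> T -> 'rV[R]_d) (tau s0 t0 : R).
Hypotheses (s0_ge0 : 0 <= s0) (s0t0 : s0 < t0) (t0tau : t0 <= tau).

(** Grid and truncation are refined together, so that this increases with [n]
    to the supremum of the whole path. *)
Definition dyadic_max n w : R :=
  trunc_max n%:R (fun j => enorm (X (dyadic s0 (t0 - s0) n j) w)) (2 ^ n).+1.

Lemma dyadic_max_mono w : {homo dyadic_max^~ w : m n / (m <= n)%N >-> m <= n}.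
Proof.
apply: homo_leq => [//|x y z|n]; first exact: le_trans.
apply: trunc_max_lub => [|j jn]; first exact: trunc_max_ge0.
have jn' : (j.*2 < (2 ^ n.+1).+1)%N by rewrite expnS; lia.
apply: le_trans (trunc_max_ub _ _ jn'); rewrite dyadic_double.
by rewrite le_min ge_min ler_nat leqnSn/= ge_min lexx orbT.
Qed.

(** By continuity the path stays above [y] near [u], where there are points of
    arbitrarily fine grids; the grid is taken fine enough for the truncation to
    exceed [y] too. *)
Lemma dyadic_max_gt w u y :
  {within `[0, tau], continuous (fun t : R => X t w)} ->
  s0 <= u <= t0 -> y < enorm (X u w) -> exists n, y <= dyadic_max n w.
Proof.
move=> Xcont /andP[su ut] yX.
have Au : u \in `[0, tau] by rewrite in_itv/= (le_trans s0_ge0)//= (le_trans ut).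
have Xu := (subspace_continuousP _ _).1 Xcont u Au.
have Eu : (fun v => enorm (X v w)) v @[v --> within `[0, tau] (nbhs u)]
    --> enorm (X u w).
  exact: (continuous_cvg _ (@continuous_enorm R d (X u w)) Xu).
have /nbhs_ballP[e /= e0 He] :
    nbhs u (fun v => `[0, tau]%classic v -> y < enorm (X v w)).
  exact: (cvgr_gt _ Eu _ yX).
have L0 : 0 < t0 - s0 by rewrite subr_gt0.
have [|n [j [yn jn uj]]] := @dyadic_dense _ s0 (t0 - s0) u e
    (Num.truncn `|y|).+1 L0 e0.
  by rewrite subrKC su.
exists n; have jn' : (j < (2 ^ n).+1)%N by [].
apply: le_trans (trunc_max_ub _ _ jn'); rewrite le_min; apply/andP; split.
  apply: le_trans (ler_norm _) _; apply: le_trans (ltW (truncnS_gt _)) _.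
  by rewrite ler_nat.
apply/ltW/He => //.
have := dyadic_itv s0 (ltW L0) jn; rewrite subrKC in_itv/= => /andP[s_le le_t].
by rewrite (le_trans s0_ge0 s_le) (le_trans le_t t0tau).
Qed.

Lemma running_sup_ge0 w : (0 <= running_sup X s0 t0 w)%E.
Proof.
apply: (@le_trans _ _ (enorm (X s0 w))%:E); first by rewrite lee_fin enorm_ge0.
by apply: ereal_sup_ubound; exists s0 => //=; rewrite in_itv/= lexx ltW.
Qed.

Lemma running_sup_powR_le (q : R) w : 0 < q ->
  {within `[0, tau], continuous (fun t : R => X t w)} ->
  (running_sup X s0 t0 w `^ q <= limn (fun n => (dyadic_max n w `^ q)%:E))%E.
Proof.
move=> q0 Xcont; set l := limn _.
have nd : {homo (fun n => (dyadic_max n w `^ q)%:E) : m n / (m <= n)%N >-> (m <= n)%E}.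
  move=> m n mn; rewrite lee_fin ge0_ler_powR ?nnegrE ?(ltW q0)//.
  - exact: trunc_max_ge0.
  - exact: trunc_max_ge0.
  - exact: dyadic_max_mono.
have le_l n : ((dyadic_max n w `^ q)%:E <= l)%E.
  rewrite /l (cvg_lim _ (ereal_nondecreasing_cvgn nd))//.
  by apply: ereal_sup_ubound; exists n.
have l0 : (0 <= l)%E by apply: le_trans (le_l 0); rewrite lee_fin powR_ge0.
have le_root : (running_sup X s0 t0 w <= l `^ q^-1)%E.
  apply: ge_ereal_sup => _ [u /= ust <-]; rewrite leNgt; apply/negP.
  have : (0 <= l `^ q^-1)%E by exact: poweR_ge0.
  case E : (l `^ q^-1)%E => [r| |//] r0; last by rewrite ltNge leey.
  rewrite lte_fin => rX.
  (* The midpoint is a level that the grids reach but [r] forbids. *)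
  have [n] := @dyadic_max_gt w u ((r + enorm (X u w)) / 2) Xcont ust (midf_lt rX).2.
  apply/negP; rewrite -ltNge; apply: le_lt_trans (midf_lt rX).1.
  rewrite -lee_fin -E.
  have -> : (dyadic_max n w)%:E = ((dyadic_max n w `^ q)%:E `^ q^-1)%E.
    rewrite poweR_EFin -powRrM divff ?gt_eqF// powRr1//; exact: trunc_max_ge0.
  apply: gt0_ler_poweR => //.
  - by rewrite invr_ge0 ltW.
  - by rewrite in_itv/= leey lee_fin powR_ge0.
  - by rewrite in_itv/= leey l0.
have -> : (l = (l `^ q^-1) `^ q)%E by rewrite -poweRrM mulVf ?gt_eqF// poweRe1.
apply: gt0_ler_poweR => //.
- exact: ltW.
- by rewrite in_itv/= leey running_sup_ge0.
- by rewrite in_itv/= leey poweR_ge0.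
Qed.

End running_supremum.

Theorem theorem1p2 (R : realType) (p h : R)
    (hp : 1 < p) (h0 : 0 < h) (h1 : h <= 1) (hph : 1 < p * h) :
  exists2 C : R, 0 < C &
    forall (disp : measure_display) (Omega : measurableType disp)
      (P : probability Omega R) (F : R -> set (set Omega))
      (d : nat) (tau A : R) (X : R -> Omega -> 'rV[R]_d),
    filtration F -> usual_conditions P F ->
    0 < tau -> 0 <= A ->
    adapted F tau X -> continuous_process P tau X ->
    cond_increment_control P F tau X p h A ->
    forall s0 t0 : R, 0 <= s0 -> s0 < t0 -> t0 <= tau ->
    forall q : R, 1 < q -> q <= p ->
    (Lnorm P q%:E (running_sup X s0 t0) <=
      (q / (q - 1))%R%:E *
        ((C `^ p^-1 * A `^ p^-1 * `|t0 - s0| `^ h)%R%:E +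
         Lnorm_vec P q (X t0)))%E.
Proof.
exists (chain_const p h); first exact: chain_const_gt0.
move=> disp Omega P F d tau A X Ffilt _ tau0 A0 Xad Xcont Xctrl s0 t0 s00 s0t0 t0tau q q1 qp.
rewrite (@ger0_norm _ (t0 - s0)); last by rewrite subr_ge0 ltW.
set B := (_ * _)%E.
have q0 : 0 < q := lt_trans ltr01 q1.
have B0 : (0 <= B)%E.
  apply: mule_ge0; first by rewrite lee_fin divr_ge0 ?subr_ge0 ?ltW.
  by apply: adde_ge0; rewrite ?lee_fin ?mulr_ge0 ?powR_ge0// Lnorm_ge0.
pose M n w := dyadic_max X s0 t0 n w.
have ML n : ('N[P]_q%:E[EFin \o M n] <= B)%E.
  exact: (dyadic_maximal_inequality hp hph Ffilt A0 Xad Xctrl s00 s0t0 t0tau q1 qp n (ler0n R n)).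
have mM n : measurable_fun [set: Omega] (fun w => M n w `^ q).
  apply: (@measurableT_comp _ _ _ _ _ _ (@powR R ^~ q)) => //.
  apply: measurable_trunc_max => j jn; apply: measurable_enorm.
  have L0 : 0 <= t0 - s0 by rewrite subr_ge0 ltW.
  have := dyadic_itv s0 L0 jn; rewrite subrKC => /andP[sj jt].
  have jtau : 0 <= dyadic s0 (t0 - s0) n j <= tau.
    by rewrite (le_trans s00 sj) (le_trans jt t0tau).
  by case: (Xctrl.1 _ jtau).
have Mnd w : {homo (fun n => (M n w `^ q)%:E) : m n / (m <= n)%N >-> (m <= n)%E}.
  move=> m n mn; rewrite lee_fin ge0_ler_powR ?nnegrE ?(ltW q0)//.
  - exact: trunc_max_ge0.
  - exact: trunc_max_ge0.
  - exact: dyadic_max_mono.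
have intM n : (\int[P]_w (M n w `^ q)%:E <= B `^ q)%E.
  have -> : (\int[P]_w (M n w `^ q)%:E = 'N[P]_q%:E[EFin \o M n] `^ q)%E.
    rewrite ge0_LnormE => [|w]; last exact: trunc_max_ge0.
    rewrite -poweRrM mulVf ?gt_eqF// poweRe1//.
    by apply: integral_ge0 => w _; rewrite lee_fin powR_ge0.
  apply: gt0_ler_poweR => //; first exact: ltW.
    by rewrite in_itv/= leey Lnorm_ge0.
  by rewrite in_itv/= leey B0.
have mlim : measurable_fun [set: Omega] (fun w => limn (fun n => (M n w `^ q)%:E)).
  apply: (emeasurable_fun_cvg (fun n w => (M n w `^ q)%:E)) => [n|w _].
    exact/measurable_EFinP.
  exact: ereal_nondecreasing_is_cvgn.
have int_lim : (\int[P]_w limn (fun n => (M n w `^ q)%:E) <= B `^ q)%E.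
  rewrite (monotone_convergence P measurableT).
  - apply: lime_le; last by apply: nearW => n; exact: intM.
    apply: ereal_nondecreasing_is_cvgn => m n mn; apply: ge0_le_integral => //.
    + by move=> w _; rewrite lee_fin powR_ge0.
    + exact/measurable_EFinP.
    + exact/measurable_EFinP.
    + by move=> w _; exact: Mnd.
  - by move=> n; exact/measurable_EFinP.
  - by move=> n w _; rewrite lee_fin powR_ge0.
  - by move=> w _; exact: Mnd.
have int_sup : (\int[P]_w (`|running_sup X s0 t0 w| `^ q) <= B `^ q)%E.
  apply: le_trans int_lim; apply: ae_le_integral_nonmeasurable => //.
  - by move=> w; exact: poweR_ge0.
  - move=> w; apply: lime_ge; first exact: ereal_nondecreasing_is_cvgn.
    by apply: nearW => n; rewrite lee_fin powR_ge0.
  - apply: filterS Xcont => w Xw; rewrite gee0_abs; last exact: running_sup_ge0.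
    exact: (running_sup_powR_le s00 s0t0 t0tau q0 Xw).
rewrite unlock.
have -> : (B = (B `^ q) `^ q^-1)%E by rewrite -poweRrM divff ?gt_eqF// poweRe1.
apply: gt0_ler_poweR => //.
- by rewrite invr_ge0 ltW.
- by rewrite in_itv/= leey integral_ge0// => w _; exact: poweR_ge0.
- by rewrite in_itv/= leey poweR_ge0.
Qed.
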